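(* Let $\mathcal{D}$ be a non-principal ultrafilter on $\omega$. If $\mathcal{D}$ is not an NWD-ultrafilter, then $\mathcal{D}$ does not have property $M$.
   Context: Notation: ${}^{<\omega}2$ is the set of finite $0$-$1$ sequences, ${}^{\omega}2$ the Cantor space, $\trianglelefteq$ means ''is an initial segment of''. A set $A\subseteq{}^{<\omega}2$ is nowhere dense if for every $\eta\in{}^{<\omega}2$ there is $\nu\in{}^{<\omega}2$ with $\eta\trianglelefteq\nu$ such that no $\rho\in A$ satisfies $\nu\trianglelefteq\rho$. A non-principal ultrafilter $\mathcal{D}$ on $\omega$ is an NWD-ultrafilter if for every sequence $\langle\eta_n:n<\omega\rangle$ of elements of ${}^{<\omega}2$ there is $A\in\mathcal{D}$ such that $\{\eta_n:n\in A\}$ is nowhere dense. A tree $T\subseteq{}^{<\omega}2$ is a set closed under initial segments, and $\lim(T)=\{\eta\in{}^{\omega}2:(\forall n<\omega)\ \eta\restriction n\in T\}$. Let $\mu$ be Lebesgue measure (the product probability measure) on ${}^{\omega}2$. A non-principal ultrafilter $\mathcal{D}$ on $\omega$ has property $M$ if: for every real $\varepsilon>0$ and every sequence $\langle T_n:n<\omega\rangle$ of trees $T_n\subseteq{}^{<\omega}2$ with $\mu(\lim(T_n))\ge\varepsilon$ for all $n$, there is $A\in\mathcal{D}$ such that $\bigcap_{n\in A}\lim(T_n)\neq\emptyset$. *)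

(* Defs.v *)
From HB Require Import structures.
From mathcomp Require Import all_boot all_order all_algebra.
From mathcomp Require Import all_classical all_reals all_analysis.
From mathcomp Require Import measurable_realfun.

Set Implicit Arguments.
Unset Strict Implicit.
Unset Printing Implicit Defensive.

Import Order.TTheory GRing.Theory Num.Theory.

Local Open Scope classical_set_scope.
Local Open Scope ring_scope.

Definition nonprincipal_ultrafilter (D : set_system nat) : Prop :=
  UltraFilter D /\ forall n : nat, D <> principal_filter n.

(* On finite 0-1 sequences, [prefix s t] says that s is an initial segment
   of t. *)
Definition nowhere_dense_seqs (A : set (seq bool)) : Prop :=
  forall s : seq bool, exists2 t : seq bool, prefix s t &
    forall r : seq bool, A r -> ~~ prefix t r.

Definition NWD_ultrafilter (D : set_system nat) : Prop :=
  nonprincipal_ultrafilter D /\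
  forall eta : nat -> seq bool,
    exists2 A : set nat, D A & nowhere_dense_seqs (eta @` A).

Definition tree (T : set (seq bool)) : Prop :=
  forall s t : seq bool, prefix s t -> T t -> T s.

(* [mkseq x n] is the restriction of x to n. *)
Definition tree_lim (T : set (seq bool)) : set cantor_space :=
  [set x : cantor_space | forall n : nat, T (mkseq x n)].

Definition cylinder (s : seq bool) : set cantor_space :=
  [set x : cantor_space | mkseq x (size s) = s].

(* The Cantor space with its product sigma-algebra. *)
Definition cantorm := g_sigma_algebraType (range cylinder).

Section binary_expansion.
Context {R : realType}.

(* For 0 <= x < 1, the n-th binary digit of x after the point (from n = 0).
   At x = 1 all digits are 0; this affects a null set only. *)
Definition binary_expansion (x : measurableTypeR R) : cantorm :=
  fun n : nat => odd (Num.truncn (x * 2 ^+ n.+1)).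

Definition bits_value (s : seq bool) : nat :=
  foldl (fun k (b : bool) => (b + k.*2)%N) 0%N s.

Lemma bits_value_rcons s b :
  bits_value (rcons s b) = (b + (bits_value s).*2)%N.
Proof. by rewrite /bits_value foldl_rcons. Qed.

Lemma bits_value_lt s : (bits_value s < 2 ^ size s)%N.
Proof.
elim/last_ind: s => [//|s b ih].
rewrite bits_value_rcons size_rcons expnS mul2n; case: b => /=; last first.
  by rewrite add0n ltn_double.
by rewrite add1n ltn_Sdouble.
Qed.

Lemma truncn_double (y : R) : 0 <= y ->
  Num.truncn (y * 2) = (odd (Num.truncn (y * 2)) + (Num.truncn y).*2)%N.
Proof.
move=> y0; have y20 : 0 <= y * 2 by rewrite mulr_ge0.
suff -> : Num.truncn y = (Num.truncn (y * 2))./2 by rewrite odd_double_half.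
have /andP[h1 h2] := truncn_itv y20.
set m := Num.truncn (y * 2) in h1 h2 *.
apply: truncn_def; apply/andP; split.
  rewrite -(ler_pM2r (ltr0n R 2)) -natrM muln2 (le_trans _ h1)// ler_nat.
  by rewrite -[leqRHS]odd_double_half leq_addl.
rewrite -(ltr_pM2r (ltr0n R 2)) -natrM muln2 (lt_le_trans h2)// ler_nat.
by rewrite -[in leqLHS](odd_double_half m) doubleS ltnS; case: (odd m).
Qed.

Lemma binary_expansion_mkseq (x : R) n : 0 <= x < 1 ->
  bits_value (mkseq (binary_expansion x) n) = Num.truncn (x * 2 ^+ n).
Proof.
move=> /andP[x0 x1]; elim: n => [|n ih].
  by rewrite expr0 mulr1/= (@truncn_def _ _ 0%N)// x0 x1.
rewrite mkseqS bits_value_rcons ih exprSr mulrA truncn_double; last first.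
  by rewrite mulr_ge0// exprn_ge0.
by rewrite /binary_expansion exprSr mulrA.
Qed.

Lemma bits_value_inj s t : size s = size t -> bits_value s = bits_value t ->
  s = t.
Proof.
elim/last_ind: s t => [[]//|s b ih]; elim/last_ind => [|t c _].
  by rewrite size_rcons.
rewrite !size_rcons !bits_value_rcons => -[st] e.
have bc : b = c.
  by have := congr1 odd e; rewrite !oddD !odd_double !addbF !oddb.
rewrite bc in e *; congr rcons; apply: ih => //.
by move/addnI : e => /double_inj.
Qed.

Lemma preimage_cylinder s :
  `[0%R, 1%R[ `&` binary_expansion @^-1` cylinder s =
  `[(bits_value s)%:R / 2 ^+ size s, (bits_value s).+1%:R / 2 ^+ size s[%classic
  :> set R.
Proof.
have p0 : 0 < 2 ^+ size s :> R by rewrite exprn_gt0.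
have bl := bits_value_lt s.
apply/seteqP; split => x /=; rewrite !in_itv/=.
  move=> [x01]; rewrite /cylinder/= => xs.
  have := binary_expansion_mkseq (size s) x01.
  rewrite xs => e; move/andP : x01 => [x0 x1].
  rewrite ler_pdivrMr// ltr_pdivlMr// e; apply: truncn_itv.
  by rewrite mulr_ge0// ltW.
rewrite ler_pdivrMr// ltr_pdivlMr// => /andP[h1 h2].
have x0 : 0 <= x by rewrite -(pmulr_lge0 _ p0) (le_trans _ h1).
have x1 : x < 1.
  rewrite -(ltr_pM2r p0) mul1r (lt_le_trans h2)// -natrX ler_nat.
  exact: bl.
split; first by rewrite x0.
apply: bits_value_inj; first by rewrite size_mkseq.
rewrite binary_expansion_mkseq ?x0//.
by apply: truncn_def; rewrite h1.
Qed.

Lemma measurable_binary_expansion :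
  measurable_fun [set: measurableTypeR R] binary_expansion.
Proof.
have mdigit n b : measurable [set x : measurableTypeR R | binary_expansion x n = b].
  rewrite (_ : [set _ | _] = \bigcup_(m in [set m | odd m = b])
      [set x : R | Num.truncn (x * 2 ^+ n.+1) = m]); last first.
    by apply/seteqP; split => [x /= xb|x [m /= mb xm]]; [eexists; eauto|
      rewrite /binary_expansion xm].
  apply: bigcup_measurable => m _; apply: is_interval_measurable.
  move=> x z /= xm zm y /andP[xy yz]; apply/eqP; rewrite eqn_leq.
  have p0 : 0 < 2 ^+ n.+1 :> R by rewrite exprn_gt0.
  apply/andP; split; [rewrite -zm|rewrite -xm];
    by apply: le_truncn; rewrite ler_pM2r.
apply: (@measurability _ _ (measurableTypeR R) cantorm _ _ (range cylinder)) => // _ [_ [s _ <-] <-].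
rewrite setTI (_ : _ @^-1` _ =
  \bigcap_(n in [set n | (n < size s)%N])
    [set x | binary_expansion x n = nth false s n]).
  exact: bigcap_measurableType.
apply/seteqP; split => x /=.
  by move=> xs n /= ns; rewrite -[in RHS]xs nth_mkseq.
move=> h; apply: (@eq_from_nth _ false); rewrite size_mkseq// => n ns.
by rewrite nth_mkseq//; exact: h.
Qed.

HB.instance Definition _ := isMeasurableFun.Build _ _ (measurableTypeR R) cantorm
  binary_expansion measurable_binary_expansion.

End binary_expansion.

(* Lebesgue measure on the Cantor space: the law of the binary digits of a
   uniform point of [0, 1]. By [cantor_measure_cylinder] it is the product of
   the uniform probabilities on {0, 1}. *)
Definition cantor_measure (R : realType) : probability cantorm R :=
  distribution (uniform_prob (@ltr01 R)) (@binary_expansion R).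

Lemma cantor_measure_cylinder (R : realType) (s : seq bool) :
  cantor_measure R (cylinder s) = ((2 ^+ size s)^-1)%:E.
Proof.
rewrite /cantor_measure/= /distribution/= /pushforward.
have p0 : 0 < 2 ^+ size s :> R by rewrite exprn_gt0.
set A : set R := _ @^-1` _.
have mA : measurable A.
  rewrite -[A]setTI; apply: measurable_binary_expansion => //.
  by apply: sub_sigma_algebra; exists s.
rewrite /uniform_prob integral_uniform_pdf.
have mA1 : measurable (A `&` `[0%R, 1%R]) by exact: measurableI.
rewrite (eq_integral (fun=> 1%E)); last first.
  move=> x /set_mem[_]; rewrite /= in_itv/= /uniform_pdf => ->.
  by rewrite subr0 invr1.
rewrite integral_cst// mul1e.
rewrite (_ : A `&` _ = (`[0%R, 1%R[ `&` A) `|` (A `&` [set 1%R])); last first.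
  rewrite -(@setUitv1 _ _ _ _ true) ?bnd_simp//.
  by rewrite setIUr (setIC A `[0%R, 1%R[%classic).
rewrite measureU0; [|exact: measurableI|exact: measurableI|]; last first.
  apply/eqP; rewrite eq_le measure_ge0 andbT.
  rewrite -(@lebesgue_measure_set1 R 1) le_measure ?inE//.
  exact: measurableI.
rewrite /A preimage_cylinder; apply: (eq_trans (lebesgue_measure_itv _)).
rewrite /= lte_fin.
rewrite ltr_pM2r ?invr_gt0// ltr_nat ltnSn -EFinB -mulrBl.
by rewrite -natrB// subSnn mul1r.
Qed.

Lemma measurable_tree_lim (T : set (seq bool)) :
  measurable (tree_lim T : set cantorm).
Proof.
rewrite (_ : tree_lim T = \bigcap_n
  \bigcup_s (if pselect (T s /\ size s = n) then cylinder s else set0)).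
  apply: bigcap_measurableType => n _; apply: countable_bigcupT_measurable.
    exact: countableP.
  move=> s; case: ifPn => // _; apply: sub_sigma_algebra; by exists s.
apply/seteqP; split => x /=.
  move=> Tx n _; exists (mkseq x n) => //; rewrite size_mkseq.
  by case: pselect => [_|[]]//=; rewrite /cylinder/= size_mkseq.
move=> h n; have [s _] := h n I.
by case: pselect => //= -[Ts sn] xs; rewrite -sn xs.
Qed.

Definition property_M (R : realType) (D : set_system nat) : Prop :=
  nonprincipal_ultrafilter D /\
  forall (eps : R) (T : nat -> set (seq bool)), 0 < eps ->
    (forall n : nat, tree (T n)) ->
    (forall n : nat, (eps%:E <= cantor_measure R (tree_lim (T n)))%E) ->
    exists2 A : set nat, D A & \bigcap_(n in A) tree_lim (T n) !=set0.

(* Main.v *)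
(* To each finite sequence r attach the closed set of the x none of whose
   restrictions to n.+2 bits occurs in r as the block starting at place n.
   The block at n removes a set of measure at most 2^-(n+2), so at least half
   of the measure is left.  Each x lies in the closed sets of a nowhere dense
   family of r only: after any s one can append the first |s|+2 bits of x, and
   x then lies in no closed set attached to a further extension.  Hence if D
   has property M, applying it to the trees of eta_n gives A in D with
   {eta_n : n in A} nowhere dense. *)
Require Import Defs.
From mathcomp Require Import all_boot all_order all_algebra.
From mathcomp Require Import all_classical all_reals all_analysis.

Set Implicit Arguments.
Unset Strict Implicit.
Unset Printing Implicit Defensive.

Import Order.TTheory GRing.Theory Num.Theory.

Local Open Scope classical_set_scope.
Local Open Scope ring_scope.

Definition block (r : seq bool) (n : nat) : seq bool := take n.+2 (drop n r).

(** The size guard discards blocks cut short by the end of [r]: an empty one is a prefix of every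
    [u] and would empty the tree. *)
Definition avoiding_tree (r : seq bool) : set (seq bool) :=
  [set u | forall n, size (block r n) = n.+2 -> ~~ prefix (block r n) u].

Definition block_cylinder (r : seq bool) (n : nat) : set cantorm :=
  if size (block r n) == n.+2 then cylinder (block r n) else set0.

Lemma tree_avoiding_tree r : tree (avoiding_tree r).
Proof.
move=> s t st Tt n nr; apply: contra (Tt n nr) => bs.
exact: prefix_trans bs st.
Qed.

Lemma prefix_mkseq (T : eqType) (x : nat -> T) m n :
  (m <= n)%N -> prefix (mkseq x m) (mkseq x n).
Proof.
by move=> mn; rewrite -(subnKC mn) /mkseq iotaD map_cat prefix_prefix.
Qed.

Lemma setC_tree_lim_avoiding_tree r :
  ~` tree_lim (avoiding_tree r) `<=` \big[setU/set0]_(n < size r) block_cylinder r n.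
Proof.
move=> x /existsNP[m /existsNP[n /not_implyP[nr /negP]]].
rewrite negbK => px; rewrite -bigcup_mkord; exists n => /=.
  (* A block of full length is nonempty, so it starts before the end of [r]. *)
  move: nr; rewrite /block size_take size_drop.
  by case: (ltnP n (size r)) => // /eqP ->.
rewrite /block_cylinder nr eqxx /cylinder/= nr.
(* The block and [mkseq x n.+2] are prefixes of [mkseq x m] of equal length, hence equal. *)
have nm : (n.+2 <= m)%N by rewrite -nr -(size_mkseq x m) size_prefix.
apply/eqP; rewrite eq_sym -[_ == _]/(block r n == _).
have := prefix_mkseq x nm; move: px.
by rewrite !prefixE nr size_mkseq => /eqP <- /eqP ->.
Qed.

Lemma measurable_block_cylinder r n : measurable (block_cylinder r n).
Proof.
rewrite /block_cylinder; case: ifP => // _.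
by apply: sub_sigma_algebra; exists (block r n).
Qed.

Section measure.
Context {R : realType}.

Lemma cantor_measure_block_cylinder r n :
  (cantor_measure R (block_cylinder r n) <= ((2 ^+ n.+2)^-1)%:E)%E.
Proof.
rewrite /block_cylinder; case: eqP => [nr|_]; last by rewrite measure0 lee_fin.
by rewrite cantor_measure_cylinder nr.
Qed.

(** The bound is the exact partial sum of the geometric series 1/4 + 1/8 + ..., which lets the
    induction close. *)
Lemma cantor_measure_bigsetU_block_cylinder r N :
  (cantor_measure R (\big[setU/set0]_(n < N) block_cylinder r n)
    <= (2^-1 - (2 ^+ N.+1)^-1)%:E)%E.
Proof.
elim: N => [|N ih]; first by rewrite big_ord0 measure0 expr1 subrr.
rewrite big_ord_recr/=; apply: le_trans.
  apply: (@measureU2 _ _ _ (cantor_measure R)); last exact: measurable_block_cylinder.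
  by apply: bigsetU_measurable => i _; exact: measurable_block_cylinder.
apply: (le_trans (leeD ih (cantor_measure_block_cylinder r N))).
rewrite -EFinD lee_fin (_ : (2 ^+ N.+1)^-1 = (2 ^+ N.+2)^-1 + (2 ^+ N.+2)^-1).
  by rewrite opprD addrA addrNK.
by rewrite [2 ^+ N.+2]exprS invfM -mulrDl -[2^-1]mul1r -splitr mul1r.
Qed.

(** The bound does not depend on [r], so one epsilon serves all the trees of a sequence. *)
Lemma cantor_measure_avoiding_tree r :
  ((2^-1)%:E <= cantor_measure R (tree_lim (avoiding_tree r)))%E.
Proof.
have mT := measurable_tree_lim (avoiding_tree r).
rewrite -(setCK (tree_lim _)) probability_setC; last exact: measurableC.
have : (cantor_measure R (~` tree_lim (avoiding_tree r)) <= (2^-1)%:E)%E.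
  apply: (@le_trans _ _ (cantor_measure R
    (\big[setU/set0]_(n < size r) block_cylinder r n))).
    apply: le_measure; rewrite ?inE; first exact: measurableC.
      by apply: bigsetU_measurable => i _; exact: measurable_block_cylinder.
    exact: setC_tree_lim_avoiding_tree.
  apply: (le_trans (cantor_measure_bigsetU_block_cylinder _ _)).
  by rewrite lee_fin lerBlDr lerDl.
move=> h; rewrite (_ : (2^-1)%:E = (1 - (2^-1)%:E :> \bar R)%E).
  exact: leeB.
by rewrite -EFinB [X in X - _](splitr 1) mul1r addrK.
Qed.

End measure.

Lemma nowhere_dense_avoiding (x : cantor_space) :
  nowhere_dense_seqs [set r | tree_lim (avoiding_tree r) x].
Proof.
move=> s; exists (s ++ mkseq x (size s).+2); first exact: prefix_prefix.
move=> r /= Tx; apply/negP => /prefixP[v rv].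
have br : block r (size s) = mkseq x (size s).+2.
  by rewrite /block rv -catA drop_size_cat// take_size_cat ?size_mkseq.
(* At this level the restriction of [x] is the forbidden block itself. *)
have := Tx (size s).+2 (size s).
by rewrite br size_mkseq prefix_refl => /(_ erefl).
Qed.

Lemma nowhere_dense_seqsS (A B : set (seq bool)) :
  A `<=` B -> nowhere_dense_seqs B -> nowhere_dense_seqs A.
Proof. by move=> AB Bn s; have [t st tB] := Bn s; exists t => // r /AB/tB. Qed.

Theorem proposition4p3 (R : realType) (D : set_system nat) :
  nonprincipal_ultrafilter D -> ~ NWD_ultrafilter D -> ~ property_M R D.
Proof.
move=> Dnp notNWD [_ DM]; apply: notNWD; split=> // eta.
have [||n|A DA [x xA]] := DM (2^-1) (fun n => avoiding_tree (eta n)).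
- by rewrite invr_gt0.
- by move=> n; exact: tree_avoiding_tree.
- exact: cantor_measure_avoiding_tree.
(* The common branch [x] puts every [eta n] with [n] in [A] into one nowhere dense set. *)
exists A => //; apply: nowhere_dense_seqsS (nowhere_dense_avoiding x).
by move=> _ [n An <-]; exact: xA.
Qed.
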